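(* Let $n\ge 3$, $2\le\Delta\le n-1$ and $-1\le\alpha<0$. For every connected unicyclic graph $G$ with $n$ vertices and maximum degree $\Delta$, \[\chi_\alpha(G)\le\begin{cases}(n-\Delta-1)3^\alpha+(n-\Delta+1)(\Delta+2)^\alpha+(2\Delta-n-1)(\Delta+1)^\alpha+4^\alpha & \text{if } \frac{n+2}{2}\le\Delta\le n-1,\\ (\Delta-2)3^\alpha+\Delta(\Delta+2)^\alpha+(n-2\Delta+2)4^\alpha & \text{if } 2\le\Delta\le\frac{n+1}{2}.\end{cases}\] For $\frac{n+2}{2}\le\Delta\le n-1$ equality holds if and only if $G=U_{n,\Delta}$. For $2\le\Delta\le\frac{n+1}{2}$ equality holds if and only if $G$ is obtained from a cycle by attaching $\Delta-2$ paths, each having at least two vertices, to one fixed vertex of the cycle.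
   Context: All graphs are finite and simple; $d(v)$ denotes the degree of $v$. A unicyclic graph is a connected graph with exactly one cycle (equivalently, $n$ vertices and $n$ edges). The general sum-connectivity index is $\chi_\alpha(G)=\sum_{uv\in E(G)}(d(u)+d(v))^\alpha$. Attaching a path $P_r$ (path on $r$ vertices) to a vertex $v$ means adding a disjoint copy of $P_r$ and an edge between $v$ and a terminal vertex of the path. For $\frac{n+2}{2}\le\Delta\le n-1$, $U_{n,\Delta}$ is the unicyclic graph obtained from a triangle by attaching $2\Delta-n-1$ pendant vertices and $n-\Delta-1$ copies of $P_2$ all to the same vertex of the triangle; it has $n$ vertices and maximum degree $\Delta$. *)

(* Defs.v *)
From Stdlib Require Import Reals.
From mathcomp Require Import all_boot.
Set Implicit Arguments. Unset Strict Implicit. Unset Printing Implicit Defensive.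

Definition simple_graph (n : nat) (e : rel 'I_n) : Prop :=
  symmetric e /\ irreflexive e.

Definition deg (n : nat) (e : rel 'I_n) (v : 'I_n) : nat := #|[set u | e v u]|.

Definition maxdeg (n : nat) (e : rel 'I_n) : nat := \max_(v : 'I_n) deg e v.

Definition edges (n : nat) (e : rel 'I_n) : {set 'I_n * 'I_n} :=
  [set p : 'I_n * 'I_n | (p.1 < p.2)%N && e p.1 p.2].

Definition connected (n : nat) (e : rel 'I_n) : Prop :=
  forall u v : 'I_n, connect e u v.

Definition unicyclic (n : nat) (e : rel 'I_n) : Prop :=
  connected e /\ #|edges e| = n.

Definition chi (n : nat) (e : rel 'I_n) (alpha : R) : R :=
  \big[Rplus/R0]_(p in edges e) Rpower (INR (deg e p.1 + deg e p.2)) alpha.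

Definition isomorphic (n : nat) (e1 e2 : rel 'I_n) : Prop :=
  exists f : 'I_n -> 'I_n, bijective f /\ forall u v, e1 u v = e2 (f u) (f v).

(* The graph obtained from the cycle C_k on vertices 0..k-1 by attaching
   paths P_{l_1}, ..., P_{l_m} (ls = [:: l_1; ...; l_m]) to vertex 0.
   Path j occupies vertices s_j, ..., s_j + l_j - 1 where
   s_j = k + l_1 + ... + l_{j}; vertex 0 is joined to s_j. *)
Definition path_start (k : nat) (ls : seq nat) (j : nat) : nat :=
  k + sumn (take j ls).

Definition attach_arc (k : nat) (ls : seq nat) (u v : nat) : bool :=
  [&& (u < k)%N, (v < k)%N & v == (u.+1 %% k)]
  || has (fun j => ((u == 0) && (v == path_start k ls j))
                   || [&& (path_start k ls j <= u)%N,
                          (u.+1 < path_start k ls j + nth 0 ls j)%N & v == u.+1])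
         (iota 0 (size ls)).

Definition attach_rel (k : nat) (ls : seq nat) : rel nat :=
  fun u v => (attach_arc k ls u v || attach_arc k ls v u) && (u != v).

(* the same graph, on vertex set 'I_n (meaningful when k + sumn ls = n) *)
Definition attach_graph (n k : nat) (ls : seq nat) : rel 'I_n :=
  fun u v => attach_rel k ls u v.

Definition U_graph (n Delta : nat) : rel 'I_n :=
  attach_graph 3 (nseq (2 * Delta - n - 1) 1 ++ nseq (n - Delta - 1) 2).

Arguments U_graph : clear implicits.

Open Scope R_scope.

Definition bound1 (n Delta : nat) (alpha : R) : R :=
  INR (n - Delta - 1) * Rpower 3 alpha
  + INR (n - Delta + 1) * Rpower (INR (Delta + 2)) alpha
  + INR (2 * Delta - n - 1) * Rpower (INR (Delta + 1)) alpha
  + Rpower 4 alpha.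

Definition bound2 (n Delta : nat) (alpha : R) : R :=
  INR (Delta - 2) * Rpower 3 alpha
  + INR Delta * Rpower (INR (Delta + 2)) alpha
  + INR (n + 2 - 2 * Delta) * Rpower 4 alpha.

(* Main.v *)
Require Import Defs.
From Stdlib Require Import Reals Lra.
From HB Require Import structures.
From mathcomp Require Import all_boot zify.
Set Implicit Arguments. Unset Strict Implicit. Unset Printing Implicit Defensive.

(* Write f x = x^alpha and mu = f 3 - f 4. Root G at a vertex v of maximum degree D by breadth-first
   search. The degree sum gives 2 - d summed over the vertices other than v as D - 2; let every
   vertex w <> v of degree d charge -mu (d-2)/(d-1) to each of its edges except the one to its parent
   (and +mu to its only edge if w is a leaf). An edge xy avoiding v then weighs at most f 4 plus its
   charges: by Bernoulli's inequality for (4/s)^(-alpha) this reduces to the rational inequality of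
   the case alpha = -1. Edges at v weigh at most f (D+2) plus their charges, with a gain kappa >= 0 at
   each leaf, where kappa = mu - (f (D+1) - f (D+2)). Summing up,
     chi <= n f 4 + D (f (D+2) - f 4) + mu (D-2) - kappa l,
   l being the number of leaves adjacent to v, with equality iff every w <> v has degree at most 2:
   otherwise some w of degree at least 3 has a child, since only one edge is not a parent edge, and
   the edge to a child is strict. Both bounds follow from l >= max (0, 2D - n - 1).
   When all w <> v have degree at most 2, the components of G - v are paths attached to v, and exactly
   one of them by both ends, so G is a cycle C_k with D - 2 paths attached at v, l of them having a
   single vertex; counting vertices, l = 2D - n - 1 iff k = 3 and every path has at most 2 vertices. *)

(** * Finite sums of reals and Bernoulli's inequality *)

HB.instance Definition _ :=
  Monoid.isComLaw.Build R R0 Rplus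
    (fun x y z => esym (Rplus_assoc x y z)) Rplus_comm Rplus_0_l.

Lemma INR_addn (m n : nat) : INR (m + n)%N = INR m + INR n.
Proof. exact: plus_INR. Qed.

Lemma INR_leq (m n : nat) : (m <= n)%N -> INR m <= INR n.
Proof. by move/leP; apply: le_INR. Qed.

Lemma bigR_const (I : finType) (P : pred I) (c : R) :
  \big[Rplus/R0]_(i | P i) c = INR #|P| * c.
Proof.
rewrite big_const; elim: #|_| => [|m IH]; first by rewrite /=; lra.
by rewrite iterS IH S_INR; lra.
Qed.

Lemma bigR_scale (I : finType) (P : pred I) (c : R) (F : I -> R) :
  \big[Rplus/R0]_(i | P i) (c * F i) = c * \big[Rplus/R0]_(i | P i) F i.
Proof.
by apply: (big_rec2 (fun x y => x = c * y)) => [|i x y _ ->]; lra.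
Qed.

Lemma bigR_le (I : finType) (P : pred I) (F G : I -> R) :
  (forall i, P i -> F i <= G i) ->
  \big[Rplus/R0]_(i | P i) F i <= \big[Rplus/R0]_(i | P i) G i.
Proof.
move=> FG; apply: (big_rec2 (fun x y => x <= y)) => [|i x y Pi xy]; first lra.
by have := FG i Pi; lra.
Qed.

Lemma bigR_lt (I : finType) (P : pred I) (F G : I -> R) (i : I) :
  P i -> F i < G i -> (forall i, P i -> F i <= G i) ->
  \big[Rplus/R0]_(i | P i) F i < \big[Rplus/R0]_(i | P i) G i.
Proof.
move=> Pi lti FG; rewrite (bigD1 i) //= [X in _ < X](bigD1 i) //=.
have := @bigR_le _ (fun j => P j && (j != i)) F G.
by move=> H; have := H (fun j => fun Pj => FG j (proj1 (andP Pj))); lra.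
Qed.

Lemma INR_sum (I : finType) (P : pred I) (F : I -> nat) :
  INR (\sum_(i | P i) F i) = \big[Rplus/R0]_(i | P i) INR (F i).
Proof. by apply: (big_morph INR INR_addn). Qed.

Lemma Bernoulli_Rpower (t y : R) :
  0 < t <= 1 -> -1 < y -> Rpower (1 + y) t <= 1 + t * y.
Proof.
move=> [t0 t1] y1; have ypos : 0 < 1 + y by lra.
suff H : exp (t * ln (1 + y)) <= t * exp (ln (1 + y)) + (1 - t) * exp 0.
  by rewrite /Rpower; move: H; rewrite exp_ln // exp_0; lra.
(* Convexity of [exp]: compare with the tangent line at the barycentre [t * u]. *)
set u := ln (1 + y).
have split_exp z : exp z = exp (t * u) * exp (z - t * u).
  by rewrite -exp_plus; congr exp; lra.
rewrite (split_exp u) (split_exp 0).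
have P := exp_pos (t * u).
have tangent z : exp (t * u) * (1 + (z - t * u)) <= exp (t * u) * exp (z - t * u).
  by apply: Rmult_le_compat_l; [lra | exact: exp_ineq1_le].
have := tangent u; have := tangent 0; nra.
Qed.

(** * Inequalities between edge weights *)

Section Weights.

Variable alpha : R.
Hypotheses (a1 : -1 <= alpha) (a0 : alpha < 0).

Definition pw (m : nat) : R := Rpower (INR m) alpha.

Lemma pw_gt0 (m : nat) : 0 < pw m.
Proof. exact: exp_pos. Qed.

Lemma pw_lt (m p : nat) : (0 < m)%N -> (m < p)%N -> pw p < pw m.
Proof.
move=> m0 mp; rewrite /pw /Rpower; apply: exp_increasing.
have M0 : 0 < INR m by apply: lt_0_INR; apply/ltP.
have MP : INR m < INR p by apply: lt_INR; apply/ltP.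
have := ln_increasing _ _ M0 MP; nra.
Qed.

Lemma pw_le (m p : nat) : (0 < m)%N -> (m <= p)%N -> pw p <= pw m.
Proof.
move=> m0; rewrite leq_eqVlt => /orP[/eqP->|mp]; first lra.
by have := pw_lt m0 mp; lra.
Qed.

(** Since x (x + 2) < (x + 1)^2 and [alpha] is negative, the middle weight is below the geometric
    mean of the outer two. That mean is written with the exponent [alpha / 2], so that AM-GM becomes
    the square of a difference. *)
Lemma pw_midconvex (m : nat) : (0 < m)%N -> 2 * pw m.+1 < pw m + pw m.+2.
Proof.
move=> m0.
have M0 : 0 < INR m by apply: lt_0_INR; apply/ltP.
set x := INR m in M0.
have sq z : Rpower z alpha = Rpower z (alpha / 2) * Rpower z (alpha / 2).
  by rewrite -Rpower_plus; congr Rpower; lra.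
rewrite /pw !S_INR -/x (sq x) (sq (x + 1 + 1)).
have H : Rpower (x + 1) alpha < Rpower x (alpha / 2) * Rpower (x + 1 + 1) (alpha / 2).
  rewrite Rpower_mult_distr; try lra.
  have -> : Rpower (x + 1) alpha = Rpower ((x + 1) * (x + 1)) (alpha / 2).
    by rewrite -Rpower_mult_distr; [exact: sq | lra | lra].
  rewrite /Rpower; apply: exp_increasing.
  have: ln (x * (x + 1 + 1)) < ln ((x + 1) * (x + 1)) by apply: ln_increasing; nra.
  nra.
set p := Rpower x (alpha / 2) in H *; set q := Rpower (x + 1 + 1) _ in H *.
have : 0 <= (p - q) * (p - q) by apply: Rle_0_sqr.
nra.
Qed.

(** By midpoint convexity consecutive gaps decrease. This gives kappa > 0 as soon as the maximum
    degree is at least 3. *)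
Lemma pw_gap_lt (m : nat) : (2 < m)%N -> pw m.+1 - pw m.+2 < pw 3 - pw 4.
Proof.
elim: m => // m IH; rewrite ltnS leq_eqVlt => /orP[/eqP<-|m2].
  by have := @pw_midconvex 3 isT; lra.
by have := IH m2; have := @pw_midconvex m.+1 isT; lra.
Qed.

Definition mu : R := pw 3 - pw 4.

Lemma mu_gt0 : 0 < mu.
Proof. by rewrite /mu; have := @pw_lt 3 4 isT isT; lra. Qed.

(** Write s^alpha as 4^alpha (4/s)^(-alpha). The exponent -alpha lies in (0, 1], so Bernoulli's
    inequality applies around s = 4. *)
Lemma pw_le_bernoulli (s : nat) :
  (0 < s)%N -> pw s <= pw 4 * (1 + - alpha * (4 / INR s - 1)).
Proof.
move=> s0; have S0 : 0 < INR s by apply: lt_0_INR; apply/ltP.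
have y1 : 0 < 4 / INR s by apply: Rdiv_lt_0_compat; lra.
have E : pw s = pw 4 * Rpower (1 + (4 / INR s - 1)) (- alpha).
  have -> : 1 + (4 / INR s - 1) = 4 / INR s by lra.
  have I4 : INR 4 = 4 by simpl; lra.
  rewrite /pw I4.
  have -> : Rpower 4 alpha = Rpower (4 / INR s) alpha * Rpower (INR s) alpha.
    by rewrite Rpower_mult_distr //; congr Rpower; field; lra.
  rewrite Rpower_Ropp; field; exact: Rgt_not_eq (exp_pos _).
rewrite E; apply: Rmult_le_compat_l; first by have := pw_gt0 4; lra.
apply: Bernoulli_Rpower; lra.
Qed.

Lemma mu_le : mu <= pw 4 * (- alpha / 3).
Proof.
rewrite /mu; have := @pw_le_bernoulli 3 isT; have -> : INR 3 = 3 by simpl; lra.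
lra.
Qed.

(* A vertex of degree [d] has degree excess [d - 2], spread evenly over its [d - 1] edges other
   than the one to its parent. *)
Definition excess (d : nat) : R := (INR d - 2) / (INR d - 1).

Lemma excess2 : excess 2 = 0.
Proof. by rewrite /excess /=; lra. Qed.

Lemma excessE (d : nat) : (2 <= d)%N -> excess d = 1 - / (INR d - 1).
Proof.
move=> d2; have := INR_leq d2; rewrite /= => D2; rewrite /excess; field; lra.
Qed.

Lemma tree_edge_leaf (a : nat) : (2 < a)%N -> pw (a + 1) < pw 4 - mu * excess a + mu.
Proof.
move=> a3; rewrite excessE; last lia.
have := INR_leq a3; rewrite !S_INR /= => A3.
have : 0 < / (INR a - 1) by apply: Rinv_0_lt_compat; lra.
have := mu_gt0; have : pw (a + 1) <= pw 4 by apply: pw_le; lia.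
nra.
Qed.

(** Removes [alpha] from the edge estimates: [mu_le] and [pw_le_bernoulli] are both linear in
    -alpha, and the condition left on [c] is exactly 1/s <= 1/4 - c/12, the case alpha = -1. *)
Lemma pw_mu_le (s : nat) (c : R) : (4 <= s)%N -> 0 <= c -> c <= 3 * (1 - 4 / INR s) ->
  pw s <= pw 4 - mu * c.
Proof.
move=> s4 c0 cs.
have H : pw s <= pw 4 * (1 + - alpha * (4 / INR s - 1)) by apply: pw_le_bernoulli; lia.
have M := mu_le; have P := pw_gt0 4.
have : mu * c <= pw 4 * (- alpha / 3) * c by apply: Rmult_le_compat_r.
have : pw 4 * (- alpha / 3) * c <= pw 4 * (- alpha / 3) * (3 * (1 - 4 / INR s)).
  apply: Rmult_le_compat_l => //.
  have : 0 < pw 4 * - alpha by apply: Rmult_lt_0_compat; lra.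
  lra.
lra.
Qed.

Lemma pw_mu_lt (s : nat) (c : R) : (4 <= s)%N -> 0 <= c -> c < 3 * (1 - 4 / INR s) ->
  pw s < pw 4 - mu * c.
Proof.
move=> s4 c0 cs.
have := @pw_mu_le s (3 * (1 - 4 / INR s)) s4; have := mu_gt0; nra.
Qed.

(** Decreasing weights reduce to b = 2. There the rational inequality, divided by a - 2, is a + 2 <
    3 (a - 1). *)
Lemma tree_edge_inner (a b : nat) :
  (2 < a)%N -> (2 <= b)%N -> pw (a + b) < pw 4 - mu * excess a.
Proof.
move=> a3 b2.
have := INR_leq a3; rewrite !S_INR /= => A3.
have : pw (a + b) <= pw (a + 2) by apply: pw_le; lia.
suff: pw (a + 2) < pw 4 - mu * excess a by lra.
apply: pw_mu_lt; first lia.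
  by rewrite /excess; apply: Rlt_le; apply: Rdiv_lt_0_compat; lra.
rewrite /excess INR_addn /=.
have -> : 3 * (1 - 4 / (INR a + (1 + 1))) = (INR a - 2) * (3 / (INR a + 2)) by field; lra.
apply: Rmult_lt_compat_l; first lra.
apply: (Rmult_lt_reg_r ((INR a - 1) * (INR a + 2))); first nra.
have -> : / (INR a - 1) * ((INR a - 1) * (INR a + 2)) = INR a + 2 by field; lra.
have -> : 3 / (INR a + 2) * ((INR a - 1) * (INR a + 2)) = 3 * (INR a - 1) by field; lra.
lra.
Qed.

(** With s = p + q the claim reads (10 - s) p q <= s (s + 2). For s <= 10, bounding p q by s^2/4
    leaves (s - 4)(s - 2) >= 0. *)
Lemma cycle_edge_ineq (p q : R) : 1 <= p -> 1 <= q -> 4 <= p + q ->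
  12 * (p * q) <= (p + q + 2) * (p * q + p + q).
Proof.
move=> p1 q1 pq4; set s := p + q in pq4 *.
have pq : 4 * (p * q) <= s * s.
  by have := Rle_0_sqr (p - q); rewrite /Rsqr /s; lra.
have pq0 : 0 < p * q by nra.
have -> : p * q + p + q = p * q + s by rewrite /s; lra.
case: (Rle_dec s 10) => s10; last by nra.
have : (10 - s) * (4 * (p * q)) <= (10 - s) * (s * s) by apply: Rmult_le_compat_l; lra.
have : 0 <= s * ((s - 4) * (s - 2)) by apply: Rmult_le_pos; [lra | apply: Rmult_le_pos; lra].
nra.
Qed.

Lemma cycle_edge (a b : nat) : (2 <= a)%N -> (2 <= b)%N ->
  pw (a + b) <= pw 4 - mu * (excess a + excess b).
Proof.
move=> a2 b2; have := INR_leq a2; have := INR_leq b2; rewrite !S_INR /= => B2 A2.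
have pos x : 2 <= x -> 0 <= (x - 2) / (x - 1).
  by move=> x2; apply: Rmult_le_pos; [lra | apply: Rlt_le; apply: Rinv_0_lt_compat; lra].
apply: pw_mu_le; first lia.
  by rewrite /excess; have := pos (INR a); have := pos (INR b); lra.
(* The polynomial inequality, used with p = a - 1 and q = b - 1, needs a + b >= 6; smaller degree
   pairs are checked directly. *)
have [[-> ->]|[[-> ->]|[[-> ->]|ab]]] :
  (a = 2 /\ b = 2)%N \/ (a = 2 /\ b = 3)%N \/ (a = 3 /\ b = 2)%N \/ (6 <= a + b)%N by lia.
- by rewrite /excess /=; lra.
- by rewrite /excess /=; lra.
- by rewrite /excess /=; lra.
have := INR_leq ab; rewrite INR_addn !S_INR /= => AB.
rewrite !excessE //.
have := @cycle_edge_ineq (INR a - 1) (INR b - 1).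
set p := INR a - 1; set q := INR b - 1.
have -> : INR a + INR b = p + q + 2 by rewrite /p /q; lra.
have p1 : 1 <= p by rewrite /p; lra.
have q1 : 1 <= q by rewrite /q; lra.
move=> /(_ p1 q1) H.
have {H} : 12 * (p * q) <= (p + q + 2) * (p * q + p + q) by apply: H; rewrite /p /q; lra.
move=> H.
apply: (Rmult_le_reg_r (p * q * (p + q + 2))); first by nra.
have -> : (1 - / p + (1 - / q)) * (p * q * (p + q + 2)) =
  (2 * (p * q) - p - q) * (p + q + 2) by field; lra.
have -> : 3 * (1 - 4 / (p + q + 2)) * (p * q * (p + q + 2)) =
  3 * (p * q) * (p + q + 2 - 4) by field; lra.
lra.
Qed.
End Weights.

(** * Charging the edges along a breadth-first tree *)

(** [r] is the distance from [v], and [par] picks a neighbour at smaller distance. A shortest walk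
    always provides one, so the default [w] in [par] is never taken when [w != v]. *)
Lemma bfs_tree (T : finType) (e : rel T) (v : T) :
  (forall w, connect e v w) ->
  exists (r : T -> nat) (par : T -> T),
    forall w, w != v ->
      [/\ e (par w) w, (r (par w) < r w)%N & e v w -> par w = v].
Proof.
move=> conn.
pose reach w m := [exists t : m.-tuple T, path e v t && (last v t == w)].
have ex w : exists m, reach w m.
  have /connectP[p pp ->] := conn w.
  by exists (size p); apply/existsP; exists (in_tuple p); rewrite pp /=.
pose r w := ex_minn (ex w).
have rP p : path e v p -> (r (last v p) <= size p)%N.
  move=> pp; rewrite /r; case: ex_minnP => m _; apply.
  by apply/existsP; exists (in_tuple p); rewrite pp /=.
have key w : w != v -> exists u, e u w && (r u < r w)%N.
  move=> wv; rewrite {2}/r; case: ex_minnP => m /existsP[t /andP[pt /eqP lt]] _.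
  case/lastP: (tval t) (size_tuple t) pt lt => [|p x] /=.
    by move=> _ _ vw; rewrite vw eqxx in wv.
  rewrite size_rcons rcons_path last_rcons => sz /andP[pp ex1] xw.
  by exists (last v p); rewrite -xw ex1 -sz ltnS rP.
pose par w := odflt w [pick u | e u w && (r u < r w)%N].
exists r, par => w wv.
have /andP[H1 H2] : e (par w) w && (r (par w) < r w)%N.
  rewrite /par; case: pickP => [u // | H].
  by have [u Hu] := key w wv; have := H u; rewrite Hu.
split=> // evw.
(* A neighbour of the root is at distance at most 1, so its parent is at distance 0, that is, the
   root itself. *)
have : (r w <= 1)%N by have := rP [:: w]; rewrite /= evw; apply.
move=> rw1; have : r (par w) = 0%N by lia.
rewrite {1}/r; case: ex_minnP => m /existsP[t /andP[_ /eqP lt]] _ m0.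
by move: lt; rewrite {m}m0 in t *; rewrite tuple0.
Qed.

Section Graph.

Variables (n : nat) (e : rel 'I_n).
Hypotheses (sym : symmetric e) (irr : irreflexive e).

Lemma degE (x : 'I_n) : deg e x = #|[pred y | e x y]|.
Proof. by rewrite /deg cardsE. Qed.

Lemma edge_neq (x y : 'I_n) : e x y -> x != y.
Proof. by move=> exy; apply/eqP => E; rewrite E irr in exy. Qed.

Lemma deg_gt0 (x y : 'I_n) : e x y -> (0 < deg e x)%N.
Proof. by move=> exy; rewrite /deg card_gt0; apply/set0Pn; exists y; rewrite inE. Qed.

Lemma size_le_deg (x : 'I_n) (t : seq 'I_n) :
  uniq t -> all (e x) t -> (size t <= deg e x)%N.
Proof.
move=> ut /allP at_; rewrite /deg cardE; apply: uniq_leq_size => // y /at_ exy.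
by rewrite mem_enum inE.
Qed.

Lemma big_darts (A : Type) (idx : A) (op : Monoid.com_law idx) (F : 'I_n -> 'I_n -> A) :
  \big[op/idx]_x \big[op/idx]_(y | e x y) F x y =
  op (\big[op/idx]_(p in edges e) F p.1 p.2) (\big[op/idx]_(p in edges e) F p.2 p.1).
Proof.
rewrite pair_big_dep /= (bigID (fun p : 'I_n * 'I_n => (p.1 < p.2)%N)) /=.
congr (op _ _).
  by apply: eq_bigl => p; rewrite inE andbC.
rewrite (reindex_inj (h := fun p : 'I_n * 'I_n => (p.2, p.1))) /=; last first.
  by move=> [a b] [c d] /= [-> ->].
apply: eq_bigl => -[a b] /=; rewrite inE /= sym andbC.
case eab: (e a b); rewrite ?andbT ?andbF //.
by rewrite -leqNgt ltn_neqAle; have := edge_neq eab => ->.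
Qed.

Lemma handshake : (\sum_x deg e x = #|edges e| + #|edges e|)%N.
Proof.
have -> : (\sum_x deg e x = \sum_x \sum_(y | e x y) 1)%N.
  by apply: eq_bigr => x _; rewrite degE sum1_card.
by rewrite (big_darts addn) /= sum1_card.
Qed.

Lemma sum_INR_deg :
  \big[Rplus/R0]_x INR (deg e x) = 2 * INR #|edges e|.
Proof. by rewrite -INR_sum handshake INR_addn; lra. Qed.

Lemma chi_darts (alpha : R) :
  \big[Rplus/R0]_x \big[Rplus/R0]_(y | e x y) pw alpha (deg e x + deg e y) =
  2 * chi e alpha.
Proof.
rewrite (big_darts Rplus) /=.
have -> : \big[Rplus/R0]_(p in edges e) pw alpha (deg e p.2 + deg e p.1) = chi e alpha.
  by apply: eq_bigr => p _; rewrite /pw addnC.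
rewrite -[X in X + _ = _]/(chi e alpha); lra.
Qed.

Lemma sum_darts_swap (F : 'I_n -> 'I_n -> R) :
  \big[Rplus/R0]_x \big[Rplus/R0]_(y | e x y) F y x =
  \big[Rplus/R0]_x \big[Rplus/R0]_(y | e x y) F x y.
Proof. by rewrite !(big_darts Rplus) /= Rplus_comm. Qed.

Section Tree.

Variables (v : 'I_n) (r : 'I_n -> nat) (par : 'I_n -> 'I_n).
Hypothesis tree : forall w, w != v ->
  [/\ e (par w) w, (r (par w) < r w)%N & e v w -> par w = v].

Lemma par_edge w : w != v -> e w (par w).
Proof. by move=> /tree[]; rewrite sym. Qed.

Lemma par_root w : w != v -> e w v -> par w = v.
Proof. by move=> /tree[_ _ H]; rewrite sym. Qed.

(** Ranks drop strictly towards the root, so two vertices cannot be each other's parent. *)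
Lemma par_asym x y : x != v -> y != v -> par x = y -> par y != x.
Proof.
move=> /tree[_ rx _] /tree[_ ry _] xy; apply/eqP => yx.
by move: rx ry; rewrite xy yx; lia.
Qed.

Lemma deg_ge2 x y : x != v -> e x y -> y != par x -> (2 <= deg e x)%N.
Proof.
move=> xv exy yp; apply: (@size_le_deg x [:: y; par x]) => /=.
  by rewrite inE yp.
by rewrite exy par_edge.
Qed.

(** These are darts (ordered pairs), so each non-tree edge avoiding the root is counted twice. *)
Definition nontree : {set 'I_n * 'I_n} :=
  [set p | [&& e p.1 p.2, p.1 != v, p.2 != v, par p.1 != p.2 & par p.2 != p.1]].

Hypothesis nedges : #|edges e| = n.

(** Of the 2n darts, the n - 1 tree edges use 2(n - 1): the upward darts [A] and the downward darts
    [B], disjoint by [par_asym]. Two darts remain, so at most one edge lies off the tree. *)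
Lemma card_nontree : (#|nontree| <= 2)%N.
Proof.
pose D := [set p : 'I_n * 'I_n | e p.1 p.2].
pose A := [set (w, par w) | w in [set~ v]]; pose B := [set (par w, w) | w in [set~ v]].
have cD : #|D| = (n + n)%N.
  rewrite -sum1dep_card -(pair_big_dep xpredT e (fun _ _ => 1%N)) /=.
  under eq_bigr do rewrite sum1_card -degE.
  by rewrite handshake nedges.
have cV : #|[set~ v]| = n.-1 by rewrite cardsC1 card_ord.
have cA : #|A| = n.-1 by rewrite card_imset // => a b [].
have cB : #|B| = n.-1 by rewrite card_imset // => a b [].
have AB : A :&: B = set0.
  apply/setP => -[x y]; rewrite !inE; apply/negP => /andP[/imsetP[a av [xa ya]] /imsetP[b bv [xb yb]]].
  move: av bv; rewrite !inE => av bv.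
  have ba : b = par a by rewrite -ya yb.
  have /eqP := par_asym av bv (esym ba).
  by apply; rewrite -xb xa.
have NAB : nontree :&: (A :|: B) = set0.
  apply/setP => -[x y]; rewrite !inE /=; apply/negP.
  move=> /andP[/and5P[_ _ _ p1 p2] /orP[]/imsetP[a av [xa ya]]].
    by rewrite xa ya eqxx in p1.
  by rewrite xa ya eqxx in p2.
have sub : nontree :|: (A :|: B) \subset D.
  rewrite !subUset; apply/and3P; split; apply/subsetP => p; rewrite !inE.
  - by case/andP.
  - by move=> /imsetP[w]; rewrite !inE => wv -> /=; exact: par_edge.
  - by move=> /imsetP[w]; rewrite !inE => wv -> /=; rewrite sym; exact: par_edge.
have := subset_leq_card sub; rewrite cD cardsU NAB cards0 subn0 cardsU AB cards0 subn0 cA cB.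
have : (0 < n)%N by case: (v) => m; case: (n).
lia.
Qed.

(** Without a child, two neighbours of [w] other than its parent would give two non-tree edges,
    hence four darts in [nontree]. *)
Lemma exists_child w : w != v -> (2 < deg e w)%N ->
  exists y, [/\ e w y, y != v & par y = w].
Proof.
move=> wv d3.
case: (pickP [pred y | [&& e w y, y != v & par y == w]]) => [y /and3P[? ? /eqP ?]|none].
  by exists y.
pose S := [set y | e w y] :\ par w.
have cS : (1 < #|S|)%N.
  by have := cardsD1 (par w) [set y | e w y]; rewrite inE par_edge // -/S; move: d3; rewrite /deg; lia.
have [y1 [y2 [y1S y2S y12]]] := card_gt1P cS.
have inN y : y \in S -> ((w, y) \in nontree) * ((y, w) \in nontree) * (w != y).
  rewrite !inE => /andP[yp ewy].
  have yv : y != v by apply: contraNneq yp => E; rewrite par_root ?E // -?E.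
  have pyw : par y != w by apply/negbT; have := none y; rewrite /= ewy yv.
  by rewrite /= (sym y w) ewy wv yv pyw eq_sym yp (edge_neq ewy).
have u4 : uniq [:: (w, y1); (w, y2); (y1, w); (y2, w)].
  have [[_ _] /negbTE n1] := inN _ y1S; have [[_ _] /negbTE n2] := inN _ y2S.
  by rewrite /= !inE !xpair_eqE !eqxx (negbTE y12) n1 n2 /= ?andbF ?orbF /= ?n1 ?n2 ?andbF.
suff : (4 <= #|nontree|)%N by have := card_nontree; lia.
rewrite cardE; apply: (uniq_leq_size u4) => p.
have [[? ?] _] := inN _ y1S; have [[? ?] _] := inN _ y2S.
by rewrite mem_enum 3!in_cons mem_seq1 => /or4P[]/eqP->.
Qed.


(* [D] is the maximum degree and [l] the number of leaves adjacent to the root [v]. *)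
Definition chi_bound (alpha : R) (D l : nat) : R :=
  INR n * pw alpha 4 + INR D * (pw alpha (D + 2) - pw alpha 4)
  - INR l * (mu alpha - (pw alpha (D + 1) - pw alpha (D + 2)))
  + mu alpha * (INR D - 2).

Definition leaf_nbrs : nat := #|[set y | e v y && (deg e y == 1%N)]|.

Variable alpha : R.
Hypotheses (a1 : -1 <= alpha) (a0 : alpha < 0).
Hypotheses (D2 : (2 <= deg e v)%N).

Local Notation f := (pw alpha).
Local Notation m := (mu alpha).
Local Notation D := (deg e v).
Local Notation kappa := (m - (f (D + 1)%N - f (D + 2)%N)).

(* The correction to [f 4] on the edge [xy] is [charge x y + charge y x]. *)
Definition charge (x y : 'I_n) : R :=
  if x == v then f (D + 2)%N - f 4 - (if deg e y == 1%N then kappa else 0)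
  else m * (if y == par x then (if deg e x == 1%N then 1 else 0) else - excess (deg e x)).

Lemma sum_charge_root :
  \big[Rplus/R0]_(y | e v y) charge v y = INR D * (f (D + 2)%N - f 4) - INR leaf_nbrs * kappa.
Proof.
rewrite /charge eqxx big_split /= bigR_const -degE; congr (_ + _).
rewrite (eq_bigr (fun y => - kappa * (if deg e y == 1%N then 1 else 0))); last first.
  by move=> y _; case: ifP; lra.
rewrite bigR_scale -big_mkcondr /= bigR_const /leaf_nbrs cardsE; lra.
Qed.

(** The d - 1 edges other than the parent edge share the excess d - 2 evenly; a leaf has only its
    parent edge, which carries the value +[mu]. *)
Lemma sum_charge (x : 'I_n) : x != v ->
  \big[Rplus/R0]_(y | e x y) charge x y = m * (2 - INR (deg e x)).
Proof.
move=> xv; rewrite /charge (negbTE xv) bigR_scale; congr (_ * _).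
rewrite (bigD1 (par x)) ?par_edge //= eqxx.
rewrite (eq_bigr (fun y => - excess (deg e x))); last by move=> y /andP[_ /negbTE->].
rewrite bigR_const.
have E : deg e x = (#|[pred y | e x y & y != par x]|).+1.
  by rewrite degE (cardD1 (par x)) inE par_edge //= add1n; congr S; apply: eq_card => y; rewrite !inE andbC.
have -> : INR #|[pred y | e x y & y != par x]| = INR (deg e x) - 1 by rewrite E S_INR; lra.
case: eqP => [->|d1]; first by rewrite /excess /=; lra.
have d2 : (2 <= deg e x)%N by rewrite E in d1 *; lia.
have := INR_leq d2; rewrite /= => H; rewrite /excess; field; lra.
Qed.

Lemma sum_charges :
  \big[Rplus/R0]_x \big[Rplus/R0]_(y | e x y) (f 4 + charge x y + charge y x) =
  2 * chi_bound alpha D leaf_nbrs.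
Proof.
under eq_bigr do rewrite big_split big_split /=.
rewrite big_split big_split /= (sum_darts_swap charge).
have -> : \big[Rplus/R0]_x \big[Rplus/R0]_(y | e x y) f 4 = 2 * INR n * f 4.
  under eq_bigr do rewrite bigR_const -degE Rmult_comm.
  rewrite bigR_scale sum_INR_deg nedges; lra.
rewrite (bigD1 v) //= sum_charge_root.
rewrite (eq_bigr (fun x => m * (2 - INR (deg e x)))); last by move=> x; apply: sum_charge.
rewrite bigR_scale.
(* With n edges the average degree is 2, so the vertices other than the root contribute D - 2. *)
have : \big[Rplus/R0]_(x < n) (2 - INR (deg e x)) = 0.
  rewrite big_split /= bigR_const card_ord.
  have -> : \big[Rplus/R0]_(x < n) - INR (deg e x) = -1 * \big[Rplus/R0]_(x < n) INR (deg e x).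
    by rewrite -bigR_scale; apply: eq_bigr => x _; lra.
  rewrite sum_INR_deg nedges; lra.
rewrite (bigD1 v) //= => H.
set S := (X in _ + m * X).
have -> : S = INR D - 2 by rewrite /S; lra.
rewrite /chi_bound; lra.
Qed.

Lemma deg_par_ge2 x y : x != v -> par y = x -> y != v -> (2 <= deg e x)%N.
Proof.
move=> xv pyx yv; apply: (@deg_ge2 x y) => //; first by rewrite -pyx; case: (tree yv).
by rewrite eq_sym (par_asym yv xv pyx).
Qed.

(** The value of kappa is chosen to make this an equality at a leaf: its charge +[mu] minus kappa
    turns f (D + 2) into f (D + 1). *)
Lemma root_edge_le y : e v y -> f (D + deg e y) <= f 4 + charge v y + charge y v.
Proof.
move=> evy; have yv : y != v by rewrite eq_sym edge_neq.
rewrite /charge eqxx (negbTE yv) par_root // ?eqxx; last by rewrite sym.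
case: eqP => [->|d1]; first lra.
have : f (D + deg e y) <= f (D + 2)%N.
  by apply: pw_le => //; [lia | have := @deg_gt0 y v; rewrite sym => /(_ evy); lia].
lra.
Qed.

(** The strict part settles the equality case, since by [exists_child] every non-root vertex of
    degree at least 3 has such an edge below it. *)
Lemma child_edge_le x y : x != v -> y != v -> par y = x ->
  f (deg e x + deg e y) <= f 4 + charge x y + charge y x /\
  ((2 < deg e x)%N -> f (deg e x + deg e y) < f 4 + charge x y + charge y x).
Proof.
move=> xv yv pyx.
have x2 := deg_par_ge2 xv pyx yv.
have eyx : e y x by rewrite -pyx par_edge.
have yp : y != par x by rewrite eq_sym (par_asym yv xv pyx).
rewrite /charge (negbTE xv) (negbTE yv) (negbTE yp) pyx eqxx.
have y1 := deg_gt0 eyx.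
have [x3|x3] := ltnP 2 (deg e x).
  suff : f (deg e x + deg e y) < f 4 + m * - excess (deg e x) + m * (if deg e y == 1%N then 1 else 0).
    by move=> H; split => [|_]; lra.
  case: eqP => [->|d1]; first by have := tree_edge_leaf a0 x3; lra.
  by have := @tree_edge_inner alpha a1 a0 (deg e x) (deg e y) x3; move=> /(_ ltac:(lia)); lra.
have -> : deg e x = 2%N by lia.
split=> // ; rewrite excess2.
case: eqP => [->|d1]; first by rewrite /mu -[(2 + 1)%N]/3%N; lra.
have : f (2 + deg e y) <= f 4 by apply: pw_le => //; lia.
lra.
Qed.

Lemma cross_edge_le x y : e x y -> x != v -> y != v -> par x != y -> par y != x ->
  f (deg e x + deg e y) <= f 4 + charge x y + charge y x.
Proof.
move=> exy xv yv pxy pyx; rewrite /charge (negbTE xv) (negbTE yv).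
rewrite [y == _]eq_sym [x == _]eq_sym (negbTE pxy) (negbTE pyx).
have := @cycle_edge alpha a1 a0 (deg e x) (deg e y).
have -> : (2 <= deg e x)%N by apply: (@deg_ge2 x y); rewrite // eq_sym.
have -> : (2 <= deg e y)%N by apply: (@deg_ge2 y x); rewrite ?(sym y) // eq_sym.
by move=> /(_ isT isT); lra.
Qed.

Lemma edge_charge_le x y : e x y -> f (deg e x + deg e y) <= f 4 + charge x y + charge y x.
Proof.
have swap a b : f (deg e b + deg e a) <= f 4 + charge b a + charge a b ->
    f (deg e a + deg e b) <= f 4 + charge a b + charge b a by rewrite addnC; lra.
move=> exy; have [E|xv] := eqVneq x v; first by rewrite E in exy *; apply: root_edge_le.
have [E|yv] := eqVneq y v.
  by rewrite E in exy *; apply: swap; apply: root_edge_le; rewrite sym.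
have [pyx|pyx] := eqVneq (par y) x; first by case: (child_edge_le xv yv pyx).
have [pxy|pxy] := eqVneq (par x) y; first by apply: swap; case: (child_edge_le yv xv pxy).
exact: cross_edge_le.
Qed.

(** With no excess away from the root, every edge weight is f (D + 1), f (D + 2), f 3 or f 4, and
    the charges reproduce each of them exactly. *)
Lemma edge_charge_eq x y : (forall w, w != v -> (deg e w <= 2)%N) ->
  e x y -> f (deg e x + deg e y) = f 4 + charge x y + charge y x.
Proof.
move=> deg2.
have root y' : e v y' -> f (D + deg e y') = f 4 + charge v y' + charge y' v.
  move=> evy; have yv : y' != v by rewrite eq_sym edge_neq.
  rewrite /charge eqxx (negbTE yv) par_root // ?eqxx; last by rewrite sym.
  case: eqP => [->|d1]; first lra.
  have -> : deg e y' = 2%N; last lra.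
  by have := deg2 _ yv; have := @deg_gt0 y' v; rewrite sym => /(_ evy); lia.
have swap a b : f (deg e b + deg e a) = f 4 + charge b a + charge a b ->
    f (deg e a + deg e b) = f 4 + charge a b + charge b a by rewrite addnC; lra.
have child a b : a != v -> b != v -> par b = a ->
    f (deg e a + deg e b) = f 4 + charge a b + charge b a.
  move=> av bv pba.
  have a2 : deg e a = 2%N by have := deg_par_ge2 av pba bv; have := deg2 _ av; lia.
  have eba : e b a by rewrite -pba par_edge.
  have bp : b != par a by rewrite eq_sym (par_asym bv av pba).
  rewrite /charge (negbTE av) (negbTE bv) (negbTE bp) pba eqxx a2 excess2.
  case: eqP => [->|d1]; first by rewrite /mu -[(2 + 1)%N]/3%N; lra.
  have -> : deg e b = 2%N; last by rewrite -[(2 + 2)%N]/4%N; lra.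
  by have := deg_gt0 eba; have := deg2 _ bv; lia.
move=> exy; have [E|xv] := eqVneq x v; first by rewrite E in exy *; apply: root.
have [E|yv] := eqVneq y v.
  by rewrite E in exy *; apply: swap; apply: root; rewrite sym.
have [pyx|pyx] := eqVneq (par y) x; first exact: child.
have [pxy|pxy] := eqVneq (par x) y; first by apply: swap; apply: child.
rewrite /charge (negbTE xv) (negbTE yv).
rewrite [y == _]eq_sym [x == _]eq_sym (negbTE pxy) (negbTE pyx).
have -> : deg e x = 2%N.
  by have := deg2 _ xv; have := @deg_ge2 x y xv exy; rewrite eq_sym pxy => /(_ isT); lia.
have -> : deg e y = 2%N.
  by have := deg2 _ yv; have := @deg_ge2 y x yv; rewrite sym eq_sym pyx exy => /(_ isT isT); lia.
by rewrite excess2 -[(2 + 2)%N]/4%N; lra.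
Qed.

Lemma chi_tree_le : chi e alpha <= chi_bound alpha D leaf_nbrs.
Proof.
suff : 2 * chi e alpha <= 2 * chi_bound alpha D leaf_nbrs by lra.
rewrite -chi_darts -sum_charges; apply: bigR_le => x _; apply: bigR_le => y.
exact: edge_charge_le.
Qed.

Lemma chi_tree_eq :
  chi e alpha = chi_bound alpha D leaf_nbrs <-> (forall w, w != v -> (deg e w <= 2)%N).
Proof.
split=> [E w wv|deg2]; last first.
  suff : 2 * chi e alpha = 2 * chi_bound alpha D leaf_nbrs by lra.
  rewrite -chi_darts -sum_charges; apply: eq_bigr => x _; apply: eq_bigr => y.
  exact: edge_charge_eq.
rewrite leqNgt; apply/negP => w3.
have [y [ewy yv pyw]] := exists_child wv w3.
suff : 2 * chi e alpha < 2 * chi_bound alpha D leaf_nbrs by lra.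
rewrite -chi_darts -sum_charges; apply: (@bigR_lt _ _ _ _ w) => //.
  apply: (@bigR_lt _ _ _ _ y) => //; last by move=> z; apply: edge_charge_le.
  by case: (child_edge_le wv yv pyw) => _; apply.
by move=> x _; apply: bigR_le => z; apply: edge_charge_le.
Qed.

End Tree.
End Graph.

Local Open Scope nat_scope.

(** * Cycles with attached paths *)

(** The values [path_start k ls j] as one list, in a form that suits induction on [ls]. *)
Fixpoint starts (k : nat) (ls : seq nat) : seq nat :=
  if ls is l :: ls' then k :: starts (k + l) ls' else [::].

(* [attach_arc k ls] has exactly one arc into each vertex [v]; this is its source. *)
Definition arc_src (k : nat) (ls : seq nat) (v : nat) : nat :=
  if v == 0 then k.-1 else if v \in starts k ls then 0 else v.-1.

(** The path part of [attach_arc], separated from the cycle so that [k] may vary in the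
    induction. *)
Definition path_arc (k : nat) (ls : seq nat) (u v : nat) : bool :=
  has (fun j => ((u == 0) && (v == path_start k ls j))
                || [&& path_start k ls j <= u,
                       u.+1 < path_start k ls j + nth 0 ls j & v == u.+1])
      (iota 0 (size ls)).

Lemma starts_ge k ls j : j \in starts k ls -> k <= j.
Proof.
elim: ls k => //= l ls IH k; rewrite inE => /orP[/eqP->//|/IH]; lia.
Qed.

Lemma starts_lt k ls j : all (leq 1) ls -> j \in starts k ls -> j < k + sumn ls.
Proof.
elim: ls k => //= l ls IH k /andP[l0 als]; rewrite inE => /orP[/eqP->|/IH]; first lia.
by move=> /(_ als); lia.
Qed.

Lemma size_starts k ls : size (starts k ls) = size ls.
Proof. by elim: ls k => //= l ls IH k; rewrite IH. Qed.

Lemma notin_starts k ls j : j < k -> j \notin starts k ls.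
Proof. by move=> jk; apply/negP => /starts_ge; lia. Qed.

Lemma uniq_starts k ls : all (leq 1) ls -> uniq (starts k ls).
Proof.
elim: ls k => //= l ls IH k /andP[l0 als]; rewrite IH // andbT.
by apply: notin_starts; lia.
Qed.

Lemma path_arc_cons k l ls u v :
  path_arc k (l :: ls) u v =
  ((u == 0) && (v == k) || [&& k <= u, u.+1 < k + l & v == u.+1]) || path_arc (k + l) ls u v.
Proof.
rewrite /path_arc /= /path_start take0 addn0; congr orb.
rewrite -[1]/(1 + 0) iotaDl has_map; apply: eq_has => j /=.
by rewrite /= add0n addnA.
Qed.

Lemma path_arcE k ls u v : 0 < k -> all (leq 1) ls ->
  path_arc k ls u v =
  (k <= v < k + sumn ls) && (if v \in starts k ls then u == 0 else u.+1 == v).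
Proof.
elim: ls k => [|l ls IH] k k0 /=; first by rewrite /path_arc /= => _; lia.
move=> /andP[l0 als]; rewrite path_arc_cons {}IH //; last lia.
rewrite inE; have [vk|vk] := leqP (k + l) v; last first.
  rewrite (negbTE (notin_starts ls vk)) orbF; case: (v =P k) => [->|vk1]; case: (u =P 0) => u0; rewrite ?andbF ?andbT /=; lia.
have -> : (v == k) = false by lia.
by rewrite /=; case: ifP => _; lia.
Qed.

Lemma attach_arcE k ls u v : 1 < k -> all (leq 1) ls ->
  u < k + sumn ls -> v < k + sumn ls ->
  attach_arc k ls u v = (u == arc_src k ls v).
Proof.
move=> k1 als un vn; rewrite /attach_arc -/(path_arc k ls u v) path_arcE //; last lia.
rewrite /arc_src; have [vk|vk] := ltnP v k; last first.
  rewrite !andbF /=; have -> : (v == 0) = false by lia.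
  by rewrite vn; case: ifP => _; lia.
rewrite (negbTE (notin_starts ls vk)) /= orbF; have [uk|uk] := ltnP u k; last first.
  by rewrite /=; case: (v =P 0) => v0; lia.
have [uk1|uk1] := eqVneq u.+1 k; first by rewrite uk1 modnn /=; case: (v =P 0) => v0; lia.
by rewrite modn_small; last lia; case: (v =P 0); lia.
Qed.

Lemma arc_src0 k ls : arc_src k ls 0 = k.-1.
Proof. by []. Qed.

Lemma arc_src_neq k ls v : 1 < k -> arc_src k ls v != v.
Proof.
by move=> k1; rewrite /arc_src; case: (v =P 0) => [->|v0]; [|case: ifP => _]; lia.
Qed.

Lemma attach_relE k ls u v : 1 < k -> all (leq 1) ls ->
  u < k + sumn ls -> v < k + sumn ls ->
  attach_rel k ls u v = (u == arc_src k ls v) || (v == arc_src k ls u).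
Proof.
move=> k1 als un vn; rewrite /attach_rel !attach_arcE //.
case: (u =P v) => [->|uv] /=; last by rewrite andbT.
by rewrite andbF; apply/esym/negbTE; rewrite orbb eq_sym arc_src_neq.
Qed.

(** Allows neighbourhoods in ['I_n] to be counted as explicit lists of natural numbers. *)
Lemma card_ord_seq n (P : pred 'I_n) (t : seq nat) :
  uniq t -> (forall i : nat, (i \in t) = [exists x : 'I_n, P x && (nat_of_ord x == i)]) ->
  #|P| = size t.
Proof.
move=> ut Pt; rewrite cardE -(size_map val); apply: perm_size.
apply: uniq_perm => //; first by rewrite map_inj_uniq ?enum_uniq //; exact: val_inj.
move=> i; rewrite Pt; apply/mapP/existsP => [[x]|[x /andP[Px /eqP<-]]].
  by rewrite mem_enum => Px ->; exists x; rewrite eqxx andbT.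
by exists x => //; rewrite mem_enum.
Qed.

(** * Degrees in a cycle with attached paths *)

Section Attach.

Variables (n k : nat) (ls : seq nat).
Hypotheses (k3 : 3 <= k) (als : all (leq 1) ls) (kn : k + sumn ls = n).

Local Notation g := (@attach_graph n k ls).
Local Notation src := (arc_src k ls).

Lemma attach_graphE (x y : 'I_n) : g x y = (nat_of_ord x == src y) || (nat_of_ord y == src x).
Proof. by rewrite /attach_graph attach_relE ?kn //; lia. Qed.

Lemma arc_src_lt (x : 'I_n) : src x < n.
Proof. by rewrite /arc_src; case: eqP => ?; [|case: ifP => _]; have := ltn_ord x; lia. Qed.

(* The only possible target of an arc out of [j], for [j != 0]; the cycle closes at [k.-1]. *)
Definition arc_tgt (j : nat) : nat := if j == k.-1 then 0 else j.+1.

Lemma mem_starts_k : k < n -> k \in starts k ls.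
Proof. by rewrite -kn; case: (ls) => [|l s] /=; [lia | rewrite inE eqxx]. Qed.

Lemma arc_srcK (x y : nat) : y < n -> x != 0 -> x = src y -> y = arc_tgt x.
Proof.
rewrite /arc_src /arc_tgt => yn x0; case: (y =P 0) => [-> ->|y0]; first by rewrite eqxx.
case: ifP => [_ E|ys xy]; first by rewrite E in x0.
case: (x =P k.-1) => xk; last by lia.
have E : y = k by lia.
by move: ys; rewrite E mem_starts_k //; lia.
Qed.

Lemma adj_src (x : 'I_n) : g x (Ordinal (arc_src_lt x)).
Proof. by rewrite attach_graphE eqxx orbT. Qed.

Lemma adj_neq0 (x y : 'I_n) : nat_of_ord x != 0 -> g x y -> nat_of_ord y = src x \/ nat_of_ord y = arc_tgt x.
Proof.
move=> x0; rewrite attach_graphE => /orP[/eqP E|/eqP]; last by left.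
by right; apply: arc_srcK E.
Qed.

Lemma deg_le_seq (x : 'I_n) (t : seq nat) :
  (forall y, g x y -> nat_of_ord y \in t) -> deg g x <= size t.
Proof.
move=> xt; rewrite /deg cardE -(size_map val); apply: uniq_leq_size.
  by rewrite map_inj_uniq ?enum_uniq //; exact: val_inj.
by move=> i /mapP[y]; rewrite mem_enum inE => /xt yt ->.
Qed.

Lemma attach_deg_le2 (x : 'I_n) : nat_of_ord x != 0 -> deg g x <= 2.
Proof.
move=> x0; apply: (@deg_le_seq x [:: src x; arc_tgt x]) => y /(adj_neq0 x0).
by rewrite !inE => -[]->; rewrite eqxx ?orbT.
Qed.

(** The neighbours of [x] are its source and possibly [arc_tgt x]. The latter is missing exactly
    when [x] ends a path, so that x + 1 is past the last vertex or starts the next path; at [k.-1]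
    the cycle closes instead. *)
Lemma attach_leafE (x : 'I_n) : nat_of_ord x != 0 ->
  (deg g x == 1) = (nat_of_ord x != k.-1) && ((x.+1 == n) || (x.+1 \in starts k ls)).
Proof.
move=> x0; have xn := ltn_ord x.
have d1 : 0 < deg g x by apply: deg_gt0 (adj_src x).
have [H|H] := boolP (_ && _).
  suff : deg g x <= 1 by lia.
  apply: (@deg_le_seq x [:: src x]) => y; rewrite inE attach_graphE => /orP[/eqP xy|//].
  case/andP: H => xk; have := arc_srcK (ltn_ord y) x0 xy.
  rewrite /arc_tgt (negbTE xk) => yx; rewrite -yx => /orP[|ys]; first by have := ltn_ord y; lia.
  by move: xy x0; rewrite /arc_src ys; case: (nat_of_ord y =P 0) => //; lia.
have tn : arc_tgt x < n.
  by move: H; rewrite /arc_tgt; case: (nat_of_ord x =P k.-1) => //= _; rewrite ?negb_or => *; lia.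
suff [st nst] : src (arc_tgt x) = x /\ arc_tgt x != src x.
  have : 2 <= deg g x; last by lia.
  apply: (@size_le_deg _ _ x [:: Ordinal (arc_src_lt x); Ordinal tn]).
    by rewrite /= inE -val_eqE /= eq_sym nst.
  by rewrite /= adj_src /= attach_graphE /= st eqxx.
move: H; rewrite /arc_tgt; case: (nat_of_ord x =P k.-1) => /= [xk _|xk].
  rewrite /arc_src -xk eqxx; split => //; rewrite (negbTE x0).
  by rewrite (negbTE (@notin_starts k ls x _)); lia.
rewrite negb_or => /andP[_ xs]; rewrite /arc_src (negbTE xs) /= (negbTE x0); split=> //.
by case: ifP => _; lia.
Qed.

(** Vertex 0 sees 1 and k - 1 on the cycle, distinct because k >= 3, and the start of each path. *)
Lemma attach_deg0 (z : 'I_n) : nat_of_ord z = 0 -> deg g z = (size ls).+2.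
Proof.
move=> z0; rewrite -(size_starts k ls) degE.
rewrite (@card_ord_seq _ _ [:: 1, k.-1 & starts k ls]) //.
  by rewrite /= !inE uniq_starts // !(negbTE (@notin_starts k ls _ _)); lia.
move=> i; apply/idP/existsP => [|[y /andP[/= ]]]; last first.
  rewrite attach_graphE !z0 arc_src0 => + /eqP<-; rewrite !inE /arc_src.
  case: (nat_of_ord y =P 0) => [->|y0] /=; first by lia.
  by have [ys|ys] := boolP (nat_of_ord y \in starts k ls); [rewrite !orbT | lia].
have sub j : j < n -> 0 == src j \/ j == k.-1 -> exists x : 'I_n, g z x && (nat_of_ord x == j).
  move=> jn H; exists (Ordinal jn); rewrite eqxx andbT attach_graphE !z0 arc_src0 /=.
  by case: H => ->; rewrite ?orbT.
rewrite !inE => /or3P[/eqP->|/eqP->|/[dup] /(starts_lt als) + ist].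
- by apply: sub; [lia | left; rewrite /arc_src /= (negbTE (@notin_starts k ls 1 _)) //; lia].
- by apply: sub; [lia | right].
- rewrite kn => in_; apply: sub => //; left; rewrite /arc_src ist.
  by case: (i =P 0) => // i0; have := starts_ge ist; lia.
Qed.
End Attach.

(** A path consists of a single vertex exactly when its start is immediately followed by the next
    start or by the end of the numbering. *)
Lemma size_leaf_starts (k : nat) (ls : seq nat) : all (leq 1) ls ->
  size [seq j <- starts k ls | (j.+1 == k + sumn ls) || (j.+1 \in starts k ls)] =
  count_mem 1 ls.
Proof.
elim: ls k => //= l ls IH k /andP[l0 als].
have -> : [seq j <- starts (k + l) ls | (j.+1 == k + (l + sumn ls)) || (j.+1 \in k :: starts (k + l) ls)] =
   [seq j <- starts (k + l) ls | (j.+1 == k + l + sumn ls) || (j.+1 \in starts (k + l) ls)].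
  apply: eq_in_filter => j /starts_ge js; rewrite inE addnA.
  by have -> : (j.+1 == k) = false by lia.
have -> : ((k.+1 == k + (l + sumn ls)) || (k.+1 \in k :: starts (k + l) ls)) = (l == 1).
  rewrite inE; have -> /= : (k.+1 == k) = false by lia.
  case: (l =P 1) => [->|l1].
    by case: (ls) => [|l' s] /=; rewrite ?inE addn1 ?eqxx ?orbT //; lia.
  by rewrite (negbTE (@notin_starts (k + l) ls k.+1 _)); lia.
by case: (l == 1); rewrite /= IH.
Qed.

Lemma attach_leaf_nbrs (n k : nat) (ls : seq nat) (z : 'I_n) :
  3 <= k -> all (leq 1) ls -> k + sumn ls = n -> nat_of_ord z = 0 ->
  leaf_nbrs (@attach_graph n k ls) z = count_mem 1 ls.
Proof.
move=> k3 als kn z0; rewrite -(size_leaf_starts k als) /leaf_nbrs cardsE kn.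
apply: card_ord_seq; first by rewrite filter_uniq ?uniq_starts.
move=> i; rewrite mem_filter; apply/andP/existsP => [[ei ist]|[y /andP[/andP[zy]]]].
  have in_ := starts_lt als ist; rewrite kn in in_.
  have ik := starts_ge ist; exists (Ordinal in_); rewrite eqxx andbT.
  rewrite (attach_leafE k3 als kn) //=; last by lia.
  rewrite ei (attach_graphE k3 als kn) /= z0 {1}/arc_src ist.
  have -> : (i == 0) = false by lia.
  by rewrite eqxx andbT; lia.
move=> + /eqP<-; have y0 : nat_of_ord y != 0.
  by apply/eqP => y0; move: zy; rewrite (attach_graphE k3 als kn) !y0 !z0 arc_src0; lia.
rewrite (attach_leafE k3 als kn) // => /andP[yk H]; split=> //.
move: zy yk H; rewrite (attach_graphE k3 als kn) z0 /arc_src (negbTE y0) /= => /orP[]; last by move=> ->.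
case: ifP => // _ y1; have -> : nat_of_ord y = 1 by lia.
by rewrite (negbTE (@notin_starts k ls 2 _)); lia.
Qed.

(** * Unicyclic graphs with one vertex of degree above two *)

Lemma uniq_map_flatten (T : eqType) (h : seq T -> T) (Bs : seq (seq T)) :
  uniq (flatten Bs) -> (forall B, B \in Bs -> h B \in B) -> uniq (map h Bs).
Proof.
elim: Bs => //= B Bs IH; rewrite cat_uniq => /and3P[_ /hasPn dis uBs] hB.
rewrite IH // => [|C CB]; last by apply: hB; rewrite inE CB orbT.
rewrite andbT; apply/mapP => -[C CB E].
have : h B \notin B by apply: dis; rewrite E; apply/flattenP; exists C => //; apply: hB; rewrite inE CB orbT.
by rewrite hB // inE eqxx.
Qed.

Section Structure.

Variables (n : nat) (e : rel 'I_n).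
Hypotheses (sym : symmetric e) (irr : irreflexive e).

(* The darts [(x, p x)] and [(p x, x)] are [2 n] distinct ones, hence all of them. *)
Lemma edges_of_map (p : 'I_n -> 'I_n) :
  #|edges e| = n -> (forall x, e (p x) x) -> (forall x, p (p x) != x) ->
  forall x y, e x y = (p x == y) || (p y == x).
Proof.
move=> nedges ep pp.
pose D := [set q : 'I_n * 'I_n | e q.1 q.2].
pose A := [set (x, p x) | x in 'I_n]; pose B := [set (p x, x) | x in 'I_n].
have cD : #|D| = n + n.
  rewrite -sum1dep_card -(pair_big_dep xpredT e (fun _ _ => 1%N)) /=.
  under eq_bigr do rewrite sum1_card -degE.
  by rewrite (handshake sym irr) nedges.
have cA : #|A| = n by rewrite card_imset ?card_ord // => a b [].
have cB : #|B| = n by rewrite card_imset ?card_ord // => a b [].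
have AB : A :&: B = set0.
  apply/setP => -[x y]; rewrite !inE; apply/negP => /andP[/imsetP[a _ [xa ya]] /imsetP[b _ [xb yb]]].
  by have := pp a; rewrite -ya yb -xb xa eqxx.
have sub : A :|: B \subset D.
  rewrite subUset; apply/andP; split; apply/subsetP => q /imsetP[x _ ->]; rewrite inE //=.
  by rewrite sym.
have E : A :|: B = D.
  by apply/eqP; rewrite eqEcard sub cD cardsU AB cards0 cA cB subn0 leqnn.
move=> x y; have -> : e x y = ((x, y) \in D) by rewrite inE.
rewrite -E !inE; congr orb.
  by apply/imsetP/eqP => [[z _ [-> ->]]|<-] //; exists x.
by apply/imsetP/eqP => [[z _ [-> ->]]|<-] //; exists y.
Qed.

Variable v : 'I_n.
Hypothesis deg2 : forall w, w != v -> deg e w <= 2.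

Lemma no_three_nbrs w x y z : w != v -> uniq [:: x; y; z] -> e w x -> e w y -> e w z -> False.
Proof.
move=> wv u3 wx wy wz; have := deg2 wv.
by have /= := @size_le_deg _ e w _ u3; rewrite wx wy wz => /(_ isT); lia.
Qed.

(* For [v] of the only degree above 2, these are the components of the graph minus [v], listed as
   paths starting next to [v]. *)
Definition block (B : seq 'I_n) : Prop :=
  [/\ path e v B, uniq (v :: B), B != [::] &
      forall w y, w \in B -> e w y -> y \in v :: B].

(** [last v B1] is the predecessor of [w], namely the root when [B1] is empty. Together with [z] it
    exhausts the two neighbours allowed to [w]. *)
Lemma uniq_nbrs_inner (B1 B2 : seq 'I_n) w z :
  uniq (v :: B1 ++ [:: w, z & B2]) -> path e v (B1 ++ [:: w, z & B2]) ->
  [/\ w != v, last v B1 != z, e w (last v B1) & e w z].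
Proof.
rewrite cat_path -cat_cons cat_uniq /= => /and3P[_ + _] /and4P[_ pw wz _].
rewrite !negb_or => /and3P[wB zB _].
have {}wB : w \notin v :: B1 by rewrite inE negb_or; exact: wB.
have {}zB : z \notin v :: B1 by rewrite inE negb_or; exact: zB.
split=> //; last by rewrite sym.
  by move: wB; rewrite inE negb_or => /andP[].
by apply: contraNneq zB => <-; apply: mem_last.
Qed.

(** Extend at the end while a fresh neighbour exists. Once stuck, an earlier vertex cannot have a
    neighbour off the path either, as this would be its third. *)
Lemma block_extend (B : seq 'I_n) :
  path e v B -> uniq (v :: B) -> B != [::] ->
  exists t, block (B ++ t).
Proof.
have [m] := ubnP (n - size B); elim: m B => // m IH B lem pB uB B0.
case: (pickP [pred y | e (last v B) y && (y \notin v :: B)]) => [y /andP[ey yB]|none].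
  have uB' : uniq (v :: rcons B y) by rewrite -rcons_cons rcons_uniq yB.
  have sB : size (v :: rcons B y) <= n.
    by have := max_card (mem (v :: rcons B y)); rewrite card_ord (card_uniqP uB').
  have [|||t bt] := IH (rcons B y) _ _ uB'.
  - by move: sB; rewrite /= size_rcons; lia.
  - by rewrite rcons_path pB.
  - by case: (B).
  by exists (y :: t); rewrite -cat_rcons.
exists [::]; rewrite cats0; split=> // w y wB ewy; apply/negPn/negP => yB.
case/splitPr: wB none pB uB B0 yB => B1 [|z B2] none pB uB _ yB.
  by have := none y; rewrite last_cat /= ewy yB.
have [wv lz ewl ewz] := uniq_nbrs_inner uB pB.
apply: (no_three_nbrs wv _ ewl ewz ewy).
have lB : last v B1 \in v :: B1 by apply: mem_last.
rewrite /= !inE negb_or lz /= andbT; apply/andP; split.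
  by apply: contraNneq yB => <-; rewrite -cat_cons mem_cat lB.
by apply: contraNneq yB => <-; rewrite inE mem_cat !inE eqxx !orbT.
Qed.

(** Adjacency leaves a block only through the root, so a walk avoiding the root stays inside the
    block. *)
Lemma block_component (B p : seq 'I_n) u y :
  block B -> path e u p -> v \notin u :: p -> y \in u :: p -> y \in B -> u \in B.
Proof.
case=> _ _ _ cl; elim: p u => [|x p IH] u /=; first by rewrite !inE => _ _ /eqP->.
move=> /andP[eux pp]; rewrite inE negb_or => /andP[vu vxp].
rewrite inE => /orP[/eqP->//|yp yB].
have xB := IH _ pp vxp yp yB.
by have := cl x u xB; rewrite sym eux inE eq_sym (negbTE vu) => /(_ isT).
Qed.

(** Add blocks until every neighbour of the root is covered. The root and the blocks then form a set
    closed under adjacency, hence everything. *)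
Lemma block_cover (conn : connected e) :
  exists Bs : seq (seq 'I_n),
    [/\ forall B, B \in Bs -> block B, uniq (v :: flatten Bs) &
        forall w, w \in v :: flatten Bs].
Proof.
suff [Bs [bB uB nB]] : exists Bs : seq (seq 'I_n),
    [/\ forall B, B \in Bs -> block B, uniq (v :: flatten Bs) &
        forall w, e v w -> w \in flatten Bs].
  exists Bs; split=> // w.
  have cl : closed e (mem (v :: flatten Bs)).
    apply: intro_closed; first exact: sym_connect_sym.
    move=> x y exy; rewrite inE => /orP[/eqP xv|/flattenP[B BBs xB]].
      by rewrite inE nB ?orbT // -xv.
    have [_ _ _ clB] := bB _ BBs.
    have := clB _ _ xB exy; rewrite !inE => /orP[->//|yB].
    by apply/orP; right; apply/flattenP; exists B.
  by have := closed_connect cl (conn v w); rewrite !inE eqxx /= => <-.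
suff H m : forall Bs : seq (seq 'I_n),
   (forall B, B \in Bs -> block B) -> uniq (v :: flatten Bs) -> n - size (flatten Bs) < m ->
   exists Bs : seq (seq 'I_n), [/\ forall B, B \in Bs -> block B, uniq (v :: flatten Bs) &
        forall w, e v w -> w \in flatten Bs].
  by apply: (H n.+1 [::]) => //=; lia.
elim: m => // m IH Bs bB uB lem.
case: (pickP [pred u | e v u && (u \notin flatten Bs)]) => [u /andP[/= evu uBs]|none]; last first.
  by exists Bs; split=> // w evw; have := none w; rewrite /= evw; case: (_ \in _).
have [] := @block_extend [:: u].
- by rewrite /= evu.
- by rewrite /= inE (edge_neq irr evu).
- by [].
move=> t; set B := _ ++ t => bBB; have [pB uvB B0 clB] := bBB.
(* If the new block met an old one, following it back to its first vertex [u] would put [u] in the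
   old block. *)
have dis : ~~ has (mem B) (flatten Bs).
  apply/hasPn => y /flattenP[C CBs yC]; apply: contra uBs => /= yB.
  apply/flattenP; exists C => //; apply: (@block_component C t u y (bB _ CBs)) => //.
    by move: pB => /= /andP[].
  by move: uvB => /= /andP[].
clearbody B.
have uBBs : uniq (v :: flatten (B :: Bs)).
  move: uvB uB; rewrite !cons_uniq /= => /andP[vB uB'] /andP[vBs uBs'].
  by rewrite mem_cat negb_or vB vBs cat_uniq uB' dis.
apply: (IH (B :: Bs)) => //.
  by move=> C; rewrite inE => /orP[/eqP->|/bB].

have := max_card (mem (v :: flatten (B :: Bs))); rewrite card_ord (card_uniqP uBBs) /= size_cat.
by move: lem B0; rewrite -size_eq0; move: (size B) (size (flatten Bs)) => a b; lia.
Qed.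

Hypotheses (conn : connected e) (nedges : #|edges e| = n) (D2 : 2 <= deg e v).

Lemma deg_gt0_conn w : 0 < deg e w.
Proof.
have [->|wv] := eqVneq w v; first exact: ltnW D2.
have /connectP[[|x p] /= pp E] := conn w v; first by rewrite E eqxx in wv.
by case/andP: pp => ewx _; apply: deg_gt0 ewx.
Qed.

(** All other degrees are 1 or 2, so the degree sum 2n equals D + 2(n - 1) minus the number of these
    leaves. *)
Lemma card_leaves : #|[set w | (w != v) && (deg e w == 1)]| = deg e v - 2.
Proof.
have H := handshake sym irr; rewrite nedges (bigD1 v) //= in H.
have E : \sum_(w | w != v) deg e w + \sum_(w | w != v) (deg e w == 1) = \sum_(w : 'I_n | w != v) 2.
  rewrite -big_split /=; apply: eq_bigr => w wv.
  by have := deg2 wv; have := deg_gt0_conn w; case: (deg e w) => [|[|[]]].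
have E1 : \sum_(w : 'I_n | w != v) 2 = 2 * n.-1.
  by rewrite sum_nat_const cardC1 card_ord mulnC.
have E2 : \sum_(w | w != v) (deg e w == 1) = #|[set w | (w != v) && (deg e w == 1)]|.
  by rewrite -sum1dep_card [RHS]big_mkcondr; apply: eq_bigr => w _; case: (_ == _).
have : 0 < n by case: (v) => m; case: (n).
move=> n0; rewrite E1 E2 in E; move: H E; move: (\sum_(w < n | w != v) deg e w) => S; lia.
Qed.

(** A second neighbour of the last vertex inside the block would itself have degree 3. The size
    condition discounts the edge to the root in a one-vertex block, which does not close a cycle. *)
Lemma block_last_leaf B : block B -> ~~ ((2 <= size B) && e (last v B) v) ->
  deg e (last v B) = 1.
Proof.
case/lastP: B => [|B x] [pB uB B0 cl] // nc.
rewrite last_rcons in nc *; apply/eqP; rewrite eqn_leq deg_gt0_conn andbT leqNgt.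
apply/negP => d2.
have exl : e x (last v B) by move: pB; rewrite rcons_path sym => /andP[].
have /card_gt0P[y] : 0 < #|[set y | e x y] :\ last v B|.
  by have := cardsD1 (last v B) [set y | e x y]; move: d2; rewrite /deg inE exl; lia.
rewrite !inE => /andP[yl exy].
have xB : x \in rcons B x by rewrite mem_rcons inE eqxx.
have := cl x y xB exy; rewrite -rcons_cons mem_rcons 2!inE eq_sym (negbTE (edge_neq irr exy)) /=.
case/orP => [/eqP yv|yB].
  move: nc yl; rewrite yv in exy *; rewrite exy andbT size_rcons ltnS -ltnNge.
  by case: (B) => //=; rewrite eqxx.
move: pB uB yl; case/splitPr: yB => B1 [|z B2]; first by rewrite last_cat /= eqxx.
rewrite rcons_cat /= => pB uB yl.
have [yv lz eyl eyz] := uniq_nbrs_inner uB pB.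
apply: (no_three_nbrs yv _ eyl eyz (y := z) (z := x)); last by rewrite sym.
have uB2 : uniq ((v :: B1) ++ y :: z :: rcons B2 x) by [].
move: uB2; rewrite cat_uniq => /and3P[_ /hasPn dis u2].
rewrite /= !inE negb_or lz /= andbT.
have -> /= : last v B1 != x.
  have : x \notin v :: B1 by apply: dis; rewrite !inE mem_rcons inE eqxx !orbT.
  by apply: contraNneq => <-; apply: mem_last.
by move: u2 => /= /and3P[_ + _]; rewrite mem_rcons inE negb_or => /andP[->].
Qed.

Lemma block_nbr_root B w : block B -> w \in B -> e v w ->
  w = head v B \/ (2 <= size B) && e (last v B) v.
Proof.
case=> pB uB B0 cl wB evw.
case/splitPr: wB pB uB B0 cl => -[|u B1] [|z B2] pB uB B0 cl; [by left|by left| |].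
  by right; rewrite last_cat /= sym evw size_cat /=; lia.
have [wv lz ewl ewz] := uniq_nbrs_inner uB pB.
have ewv : e w v by rewrite sym.
exfalso; apply: (no_three_nbrs wv _ ewv ewl ewz).
rewrite /= !inE lz negb_or /= andbT andbC.
have U : uniq ((v :: u :: B1) ++ w :: z :: B2) by [].
move: uB => /= /andP[]; rewrite inE mem_cat !inE !negb_or => /andP[_ /and3P[vB1 _ /andP[-> _]]] _.
apply: contraNneq vB1 => E; have := mem_last u B1; rewrite -E inE.
by move: U; rewrite /= inE negb_or => /andP[/andP[/negbTE->]].
Qed.

(** If no block returned to the root, each neighbour of the root would be the head of a block,
    giving at least D blocks; but each block would end in its own leaf, and there are only D - 2
    leaves. *)
Lemma cycle_block Bs : (forall B, B \in Bs -> block B) -> uniq (v :: flatten Bs) ->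
  (forall w, w \in v :: flatten Bs) ->
  exists2 B, B \in Bs & (2 <= size B) && e (last v B) v.
Proof.
move=> bB /= /andP[vBs uBs] cov; apply/hasP/negPn/negP => /hasPn nc.
have head_in B : B \in Bs -> head v B \in B.
  by move=> /bB[_ _ + _]; case: B => //= x B _; rewrite inE eqxx.
have last_in B : B \in Bs -> last v B \in B.
  by move=> /bB[_ _ + _]; case: B => //= x B _; rewrite mem_last.
have up : deg e v <= size Bs.
  rewrite /deg cardE -(size_map (head v) Bs); apply: uniq_leq_size; first exact: enum_uniq.
  move=> w; rewrite mem_enum inE => evw.
  have := cov w; rewrite inE eq_sym (negbTE (edge_neq irr evw)) /= => /flattenP[B BBs wB].
  have [->|cyc] := block_nbr_root (bB _ BBs) wB evw; first exact: map_f.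
  by have := nc _ BBs; rewrite /= cyc.
suff : size Bs <= deg e v - 2 by lia.
rewrite -card_leaves cardE -(size_map (last v)); apply: uniq_leq_size.
  exact: uniq_map_flatten.
move=> w /mapP[B BBs ->]; rewrite mem_enum inE (block_last_leaf (bB _ BBs) (nc _ BBs)) eqxx andbT.
apply: contraNneq vBs => <-; apply/flattenP; exists B => //; exact: last_in.
Qed.
End Structure.

(** * Numbering the vertices as a cycle with attached paths *)

Lemma arc_src2_neq k ls j : 3 <= k -> arc_src k ls (arc_src k ls j) != j.
Proof.
move=> k3; rewrite {2}/arc_src; case: (j =P 0) => [->|j0].
  rewrite /arc_src (negbTE (@notin_starts k ls k.-1 _)); last lia.
  have -> : (k.-1 == 0) = false by lia.
  by lia.
case: ifP => [/starts_ge jk|js]; first by rewrite arc_src0; lia.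
rewrite /arc_src; case: (j.-1 =P 0) => [j1|j1]; first by lia.
by case: ifP => _; lia.
Qed.

(** In the concatenated blocks each vertex is adjacent to its predecessor, or to the root if it
    heads a block. The prefix [s0] absorbs the blocks already passed in the induction. *)
Lemma path_flatten_pred (T : eqType) (e : rel T) (v : T) (Bs : seq (seq T)) (s0 : seq T) (i : nat) :
  (forall B, B \in Bs -> path e v B) -> (forall B, B \in Bs -> 0 < size B) ->
  size s0 <= i < size s0 + size (flatten Bs) ->
  e (if i \in starts (size s0) (map size Bs) then v else nth v (s0 ++ flatten Bs) i.-1)
    (nth v (s0 ++ flatten Bs) i).
Proof.
elim: Bs s0 => [|B Bs IH] s0 pB sB /=; first by lia.
have pB0 := pB B (mem_head _ _); have sB0 := sB B (mem_head _ _).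
rewrite size_cat => ilt; have [ik|ik] := leqP (size s0 + size B) i.
  have := IH (s0 ++ B); rewrite size_cat catA inE => H.
  have -> : (i == size s0) = false by lia.
  apply: H => [C CB|C CB|]; [| |lia].
    by apply: pB; rewrite inE CB orbT.
  by apply: sB; rewrite inE CB orbT.
rewrite inE (negbTE (notin_starts _ ik)) orbF.
have /(pathP v) P := pB0.
rewrite [X in e _ X]nth_cat; have -> : (i < size s0) = false by lia.
rewrite [X in e _ X]nth_cat; have -> : i - size s0 < size B by lia.
case: eqP => [->|ne]; first by rewrite subnn; apply: (P 0).
have := P (i - size s0); rewrite nth_cat; have -> : (i.-1 < size s0) = false by lia.
rewrite nth_cat; have -> : i.-1 - size s0 < size B by lia.
have -> : i - size s0 = (i.-1 - size s0).+1 by lia.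
by move=> /=; apply; lia.
Qed.

(** Number the root first, then a block closing a cycle, then the other blocks. The source map of
    the model pulls back to a map [p] along edges of [e]; by [edges_of_map] the edge count leaves no
    further edge, so the numbering is an isomorphism. *)
Lemma unicyclic_attach (n : nat) (e : rel 'I_n) (v : 'I_n) :
  symmetric e -> irreflexive e -> connected e -> #|edges e| = n ->
  2 <= deg e v -> (forall w, w != v -> deg e w <= 2) ->
  exists (k : nat) (ls : seq nat) (f : 'I_n -> 'I_n),
    [/\ 3 <= k, all (leq 1) ls, sorted leq ls, k + sumn ls = n &
     [/\ bijective f, val (f v) = 0 & forall x y, e x y = attach_graph k ls (f x) (f y)]].
Proof.
move=> sym irr conn nedges D2 deg2.
have [Bs [bB uB cov]] := block_cover sym irr deg2 conn.
have [B0 B0s /andP[sB0 eB0]] := cycle_block sym irr deg2 conn nedges D2 bB uB cov.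
(* Sorting by length puts one-vertex paths before longer ones, the order used in [U_graph]. *)
pose rest := sort (relpre size leq) (rem B0 Bs).
have permBs : perm_eq Bs (B0 :: rest).
  by rewrite (permPl (perm_to_rem B0s)) perm_cons perm_sym perm_sort.
have {}bB B : B \in B0 :: rest -> block e v B by rewrite -(perm_mem permBs); apply: bB.
pose s := v :: B0 ++ flatten rest.
have permS : perm_eq (v :: flatten Bs) s.
  by rewrite perm_cons; have /= := perm_flatten permBs.
have us : uniq s by rewrite -(perm_uniq permS).
have {}cov w : w \in s by rewrite -(perm_mem permS).
have sn : size s = n by rewrite -(card_uniqP us) -[RHS]card_ord; apply: eq_card => x; rewrite cov.
pose k := (size B0).+1; pose ls := map size rest.
have kn : k + sumn ls = n by rewrite -sn /= size_cat size_flatten /k /ls.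
have k3 : 3 <= k by [].
have pos B : B \in rest -> 0 < size B.
  by move=> Br; have [|_ _ + _] := bB B; [rewrite inE Br orbT | case: (B)].
have als : all (leq 1) ls by apply/allP => l /mapP[B /pos + ->].
have ixn w : index w s < n by rewrite -[X in _ < X]sn index_mem.
pose f w := Ordinal (ixn w).
have fK w : nth v s (index w s) = w by apply: nth_index.
have Kf j : j < n -> index (nth v s j) s = j by move=> jn; rewrite index_uniq // sn.
pose p w := nth v s (arc_src k ls (index w s)).
have srcn w : arc_src k ls (index w s) < n := arc_src_lt k3 als kn (f w).
have pB0 : path e v B0 by have [] := bB B0 (mem_head _ _).
have ep w : e (p w) w.
  rewrite -{2}(fK w) /p /arc_src; have := ixn w; move: (index w s) => i i_n.
  (* Position 0 has source k - 1, the last vertex of [B0], and this edge closes the cycle. Positions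
     below k run along [B0]; the others lie in [rest]. *)
  case: (i =P 0) => [->|i0].
    rewrite /s /k /= -cat_cons nth_cat /= ltnSn.
    by rewrite -[size B0]/(size (v :: B0)).-1 nth_last.
  have [ik|ik] := ltnP i k; last first.
    have := @path_flatten_pred _ e v rest (v :: B0) i; rewrite -[_ ++ _]/s -/ls => H.
    suff : e (if i \in starts k ls then v else nth v s i.-1) (nth v s i) by case: ifP.
    apply: H => // [B Br|]; first by have [] := bB B; rewrite // inE Br orbT.
    by rewrite -/k ik /= size_flatten -/(shape rest) -[shape rest]/ls -/k kn.
  rewrite (negbTE (notin_starts ls ik)) /s -cat_cons !nth_cat.
  have -> : i.-1 < size (v :: B0) by rewrite /= -/k; lia.
  rewrite ik; have /(pathP v) P := pB0.
  by case: i i0 i_n ik => // i _ _ ik; apply: P.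
have ixp w : index (p w) s = arc_src k ls (index w s) by rewrite Kf.
(* The source map has no 2-cycle because the cycle has length at least 3. *)
have pp w : p (p w) != w.
  apply: contraNneq (arc_src2_neq ls (index w s) k3) => E.
  by rewrite -!ixp E.
have E := edges_of_map sym irr nedges ep pp.
exists k, ls, f; split=> //.
  by rewrite /ls sorted_map; apply: sort_sorted => x y; apply: leq_total.
split.
- exists (fun i : 'I_n => nth v s i) => [w|i] /=; first exact: fK.
  by apply: val_inj; apply: (Kf i).
- by rewrite /= eqxx.
move=> x y; rewrite E (attach_graphE k3 als kn) orbC /=.
have pE a b : (p a == b) = (index b s == arc_src k ls (index a s)).
  by apply/eqP/eqP => [<-|E']; [exact: ixp | rewrite /p -E' fK].
by rewrite !pE.
Qed.

(** * The upper bounds and their equality cases *)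

Local Open Scope R_scope.

Lemma chi_le_bound (n : nat) (e : rel 'I_n) (v : 'I_n) (alpha : R) :
  symmetric e -> irreflexive e -> connected e -> #|edges e| = n ->
  -1 <= alpha -> alpha < 0 -> (2 <= deg e v)%N ->
  chi e alpha <= chi_bound n alpha (deg e v) (leaf_nbrs e v) /\
  (chi e alpha = chi_bound n alpha (deg e v) (leaf_nbrs e v) <->
   forall w, w != v -> (deg e w <= 2)%N).
Proof.
move=> sym irr conn nedges a1 a0 D2.
have [r [par tree]] := bfs_tree (conn v).
split; first exact: (chi_tree_le sym irr tree nedges a1 a0 D2).
exact: (chi_tree_eq sym irr tree nedges a1 a0 D2).
Qed.

(** Apart from the root, each vertex has degree at least 1, and at least 2 if it is a non-leaf
    neighbour of the root. Hence 2n - D >= (n - 1) + (D - l). *)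
Lemma leaf_nbrs_ge (n : nat) (e : rel 'I_n) (v : 'I_n) :
  symmetric e -> irreflexive e -> connected e -> #|edges e| = n -> (2 <= deg e v)%N ->
  (2 * deg e v <= leaf_nbrs e v + n + 1)%N.
Proof.
move=> sym irr conn nedges D2.
have H := handshake sym irr; rewrite nedges (bigD1 v) //= in H.
have n0 : (0 < n)%N by case: (v) => m; case: (n).
have L : (\sum_(w | w != v) (1 + (e v w && (deg e w != 1))) <= \sum_(w | w != v) deg e w)%N.
  apply: leq_sum => w wv; have := deg_gt0_conn conn D2 w.
  by case: (deg e w) => [|[|d]] //= _; rewrite ?andbF // ; case: (e v w).
have C1 : (\sum_(w : 'I_n | w != v) 1 = n.-1)%N by rewrite sum1_card cardC1 card_ord.
have C2 : (\sum_(w | w != v) (e v w && (deg e w != 1)) + leaf_nbrs e v = deg e v)%N.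
  rewrite /leaf_nbrs [RHS]/deg -(cardsID [set w | deg e w == 1%N] [set w | e v w]) addnC.
  congr (_ + _)%N; first by apply: eq_card => w; rewrite !inE.
  rewrite -sum1_card big_mkcond [RHS]big_mkcond; apply: eq_bigr => w _.
  rewrite !inE; case: eqP => [->|_] /=; first by rewrite irr andbF.
  by rewrite andbC; case: (_ && _).
rewrite big_split /= C1 in L.
move: H L C2; move: (\sum_(w < n | w != v) deg e w)%N => S.
move: (\sum_(w < n | w != v) (e v w && (deg e w != 1)))%N => S'.
lia.
Qed.

Section Iso.

Variables (n : nat) (e g : rel 'I_n) (f : 'I_n -> 'I_n).
Hypotheses (bf : bijective f) (ef : forall x y, e x y = g (f x) (f y)).

Lemma iso_deg (x : 'I_n) : deg e x = deg g (f x).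
Proof.
rewrite /deg -(card_imset _ (bij_inj bf)); apply: eq_card => y; rewrite inE.
have [h hK Kh] := bf; rewrite -(Kh y) (mem_imset _ _ (bij_inj bf)) inE.
by rewrite ef.
Qed.

Lemma iso_leaf_nbrs (x : 'I_n) : leaf_nbrs e x = leaf_nbrs g (f x).
Proof.
rewrite /leaf_nbrs -(card_imset _ (bij_inj bf)); apply: eq_card => y; rewrite inE.
have [h hK Kh] := bf; rewrite -(Kh y) (mem_imset _ _ (bij_inj bf)) inE.
by rewrite ef iso_deg.
Qed.

End Iso.

Lemma iso_attach_root (n k : nat) (ls : seq nat) (e : rel 'I_n) (f : 'I_n -> 'I_n) (z : 'I_n) :
  (3 <= k)%N -> all (leq 1) ls -> (k + sumn ls)%N = n ->
  bijective f -> (forall x y, e x y = attach_graph k ls (f x) (f y)) -> val (f z) = 0%N ->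
  [/\ deg e z = (size ls).+2, leaf_nbrs e z = count_mem 1%N ls,
      forall w, w != z -> (deg e w <= 2)%N & maxdeg e = deg e z].
Proof.
move=> k3 als kn bf ef fz.
have dz : deg e z = (size ls).+2 by rewrite (iso_deg bf ef) (attach_deg0 k3 als kn).
have d2 w : w != z -> (deg e w <= 2)%N.
  move=> wz; rewrite (iso_deg bf ef); apply: (attach_deg_le2 k3 als kn).
  by rewrite -fz val_eqE (inj_eq (bij_inj bf)).
split=> //; first by rewrite (iso_leaf_nbrs bf ef) (attach_leaf_nbrs k3 als kn).
apply/eqP; rewrite eqn_leq (leq_bigmax z) andbT; apply/bigmax_leqP => w _.
have [->//|/d2 dw] := eqVneq w z; apply: leq_trans dw _; by rewrite dz.
Qed.

Lemma chi_attach (n k : nat) (ls : seq nat) (e : rel 'I_n) (alpha : R) :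
  symmetric e -> irreflexive e -> connected e -> #|edges e| = n ->
  -1 <= alpha -> alpha < 0 ->
  (3 <= k)%N -> all (leq 1) ls -> (k + sumn ls)%N = n -> isomorphic e (attach_graph k ls) ->
  maxdeg e = (size ls).+2 /\ chi e alpha = chi_bound n alpha (size ls).+2 (count_mem 1%N ls).
Proof.
move=> sym irr conn nedges a1 a0 k3 als kn [f [bf ef]].
have n0 : (0 < n)%N by lia.
have [h hK Kh] := bf.
have [] := @iso_attach_root n k ls e f (h (Ordinal n0)) k3 als kn bf ef.
  by rewrite Kh.
move=> dz lz d2 mz; rewrite mz -lz -dz; split=> //.
by apply/(chi_le_bound sym irr conn nedges a1 a0 _).2 => //; rewrite dz.
Qed.

(** Termwise, l + [l = 1] = 2 + (l - 2) for l >= 1, with truncated subtraction giving 0 at l = 1. *)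
Lemma sumn_count1 (ls : seq nat) : all (leq 1) ls ->
  (sumn ls + count_mem 1 ls = 2 * size ls + sumn [seq l - 2 | l <- ls])%N.
Proof.
elim: ls => //= l ls IH /andP[l0 /IH]; move: l0; case: l => [|[|l]] //= _; lia.
Qed.

Lemma sorted_ones_twos (ls : seq nat) :
  sorted leq ls -> all (leq 1) ls -> sumn [seq (l - 2)%N | l <- ls] = 0%N ->
  ls = nseq (count_mem 1%N ls) 1%N ++ nseq (size ls - count_mem 1%N ls) 2%N.
Proof.
elim: ls => //= l ls IH pl /andP[l0 als] s0.
have {}IH : ls = nseq (count_mem 1%N ls) 1%N ++ nseq (size ls - count_mem 1%N ls) 2%N.
  by apply: IH => //; [exact: path_sorted pl | lia].
have [->|El] : l = 1%N \/ l = 2%N by lia.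
  by rewrite /= add1n subSS -IH.
have c0 : count_mem 1%N ls = 0%N.
  apply/eqP; rewrite -leqn0 leqNgt -has_count -all_predC.
  by apply: sub_all (order_path_min leq_trans pl) => j /=; lia.
by move: IH; rewrite El /= add0n c0 !subn0 /= => <-.
Qed.

Lemma chi_bound_eq2 (n D : nat) (alpha : R) : (2 <= D)%N -> (2 * D <= n + 1)%N ->
  chi_bound n alpha D 0 = bound2 n D alpha.
Proof.
move=> D2 Dn; rewrite /chi_bound /bound2 /mu /pw.
have -> : INR 3 = 3 by simpl; lra.
have -> : INR 4 = 4 by simpl; lra.
have -> : INR (D - 2) = INR D - 2 by rewrite minus_INR; [simpl; lra | apply/leP].
have -> : INR (n + 2 - 2 * D) = INR n + 2 - 2 * INR D.
  by rewrite minus_INR ?INR_addn ?mult_INR; [simpl; lra | apply/leP; lia].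
rewrite [INR 0]/=; lra.
Qed.

Lemma chi_bound_eq1 (n D : nat) (alpha : R) : (D <= n - 1)%N -> (n + 2 <= 2 * D)%N ->
  chi_bound n alpha D (2 * D - n - 1) = bound1 n D alpha.
Proof.
move=> D2 Dn; rewrite /chi_bound /bound1 /mu /pw.
have -> : INR 3 = 3 by simpl; lra.
have -> : INR 4 = 4 by simpl; lra.
have -> : INR (n - D - 1) = INR n - INR D - 1.
  by rewrite !minus_INR; [simpl; lra | apply/leP; lia | apply/leP; lia].
have -> : INR (n - D + 1) = INR n - INR D + 1.
  by rewrite INR_addn !minus_INR; [simpl; lra | apply/leP; lia].
have -> : INR (2 * D - n - 1) = 2 * INR D - INR n - 1.
  by rewrite !minus_INR ?mult_INR; [simpl; lra | apply/leP; lia | apply/leP; lia].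
lra.
Qed.

Theorem theorem2 (n Delta : nat) (alpha : R) (e : rel 'I_n) :
  (3 <= n)%N -> (2 <= Delta)%N -> (Delta <= n - 1)%N ->
  Rle (- R1) alpha -> Rlt alpha R0 ->
  simple_graph e -> unicyclic e -> maxdeg e = Delta ->
  ((n + 2 <= 2 * Delta)%N ->
     Rle (chi e alpha) (bound1 n Delta alpha) /\
     (chi e alpha = bound1 n Delta alpha <-> isomorphic e (U_graph n Delta)))
  /\
  ((2 * Delta <= n + 1)%N ->
     Rle (chi e alpha) (bound2 n Delta alpha) /\
     (chi e alpha = bound2 n Delta alpha <->
        exists (k : nat) (ls : seq nat),
          [/\ (3 <= k)%N, size ls = (Delta - 2)%N, all (fun l => 2 <= l)%N ls,
              (k + sumn ls)%N = n & isomorphic e (attach_graph k ls)])).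
Proof.
move=> n3 D2 Dn a1 a0 [sym irr] [conn nedges] mD.
have [v vD] : {v | maxdeg e = deg e v} by apply: eq_bigmax; rewrite card_ord; lia.
rewrite {}vD in mD.
have dv2 : (2 <= deg e v)%N by rewrite mD.
have [le_tot eq_tot] := chi_le_bound sym irr conn nedges a1 a0 dv2.
have lge := leaf_nbrs_ge sym irr conn nedges dv2.
have struct : chi e alpha = chi_bound n alpha Delta (leaf_nbrs e v) ->
  exists k ls, [/\ (3 <= k)%N, all (leq 1) ls, sorted leq ls, (k + sumn ls)%N = n &
    [/\ (size ls).+2 = Delta, count_mem 1%N ls = leaf_nbrs e v & isomorphic e (attach_graph k ls)]].
  rewrite -mD => /eq_tot deg2.
  have [k [ls [f [k3 als sls kn [bf fv ef]]]]] := unicyclic_attach sym irr conn nedges dv2 deg2.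
  have [dv lv _ _] := iso_attach_root k3 als kn bf ef fv.
  by exists k, ls; split=> //; split=> //; exists f.
rewrite mD in le_tot lge; set l := leaf_nbrs e v in le_tot lge struct.
(* [chi_bound] is affine in the number of leaves at the root with slope -kappa; for [Delta] at least
   3 it is strictly decreasing, so equality forces the least number of such leaves. *)
have gap : (2 < Delta)%N -> 0 < mu alpha - (pw alpha (Delta + 1)%N - pw alpha (Delta + 2)%N).
  by move=> D3; have := pw_gap_lt a0 D3; rewrite addn1 addn2 /mu; lra.
split=> HD.
  have Etot := chi_bound_eq1 alpha Dn HD.
  have {}gap := gap ltac:(lia).
  set l0 := (2 * Delta - n - 1)%N in Etot.
  have ll : (l0 <= l)%N by rewrite /l0; lia.
  have tot_le : chi_bound n alpha Delta l <= bound1 n Delta alpha.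
    by rewrite -Etot /chi_bound; have := INR_leq ll; nra.
  split; first lra.
  split=> [E|iso].
    have E1 : chi e alpha = chi_bound n alpha Delta l by lra.
    have El : l = l0.
      apply/eqP; rewrite eqn_leq ll andbT leqNgt; apply/negP => lt.
      have := lt_INR _ _ (elimT ltP lt); move: Etot E E1; rewrite /chi_bound => *; nra.
    have [k [ls [k3 als sls kn [sz c1 iso]]]] := struct E1.
    (* Counting vertices with l = 2 Delta - n - 1 turns this identity into k + sum (l_j - 2) = 3,
       subtraction being truncated. Since k >= 3, the cycle is a triangle and no path has more than
       two vertices. *)
    have S1 := sumn_count1 als.
    have ls12 : sumn [seq (l - 2)%N | l <- ls] = 0%N by rewrite El in c1; lia.
    have kE : k = 3%N by rewrite El in c1; lia.
    rewrite (sorted_ones_twos sls als ls12) kE c1 El in iso.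
    rewrite /U_graph; have -> : (n - Delta - 1 = size ls - l0)%N by lia.
    exact: iso.
  set ls := nseq l0 1%N ++ nseq (n - Delta - 1) 2%N.
  have szl : size ls = (Delta - 2)%N by rewrite /ls size_cat !size_nseq; lia.
  have [||_ ->] := @chi_attach n 3 ls e alpha sym irr conn nedges a1 a0 isT _ _ iso.
  - by rewrite all_cat !all_nseq /= !orbT.
  - by rewrite sumn_cat !sumn_nseq; lia.
  have -> : count_mem 1%N ls = l0 by rewrite count_cat !count_nseq /=; lia.
  by have -> : (size ls).+2 = Delta by lia.
have Etot := chi_bound_eq2 alpha D2 HD.
(* For [Delta] = 2 kappa vanishes, so the product is 0 whatever [l] is. *)
have kl : 0 <= INR l * (mu alpha - (pw alpha (Delta + 1)%N - pw alpha (Delta + 2)%N)).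
  have [D3|D3] := ltnP 2 Delta; first by apply: Rmult_le_pos; [exact: pos_INR | have := gap D3; lra].
  have -> : Delta = 2%N by lia.
  by rewrite /mu -[(2 + 1)%N]/3%N -[(2 + 2)%N]/4%N; lra.
have tot_le : chi_bound n alpha Delta l <= bound2 n Delta alpha.
  by rewrite -Etot /chi_bound /=; lra.
split; first lra.
split=> [E|[k [ls [k3 sz als kn iso]]]].
  have E1 : chi e alpha = chi_bound n alpha Delta l by lra.
  have [k [ls [k3 als sls kn [sz c1 iso]]]] := struct E1.
  exists k, ls; split=> //; first by lia.
  (* For [Delta] = 2 there are no attached paths, so the length condition is vacuous; otherwise
     kappa > 0 forces l = 0, which excludes one-vertex paths. *)
  have [D3|D3] := ltnP 2 Delta; last by have -> : ls = [::] by apply: size0nil; lia.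
  have l0 : l = 0%N.
    apply/eqP; rewrite -leqn0 leqNgt; apply/negP => /ltP/lt_INR lpos.
    have := gap D3; move: Etot E E1; rewrite /chi_bound => Etot E E1 gap3.
    have : 0 < INR l * (mu alpha - (pw alpha (Delta + 1)%N - pw alpha (Delta + 2)%N)).
      exact: Rmult_lt_0_compat.
    move: Etot => /=; lra.
  move: als c1; rewrite l0; elim: (ls) => //= j s IH /andP[j1 /IH {}IH] c0.
  by rewrite IH; lia.
have als1 : all (leq 1) ls by apply: sub_all als => l'; apply: ltnW.
have [_ ->] := chi_attach sym irr conn nedges a1 a0 k3 als1 kn iso.
have -> : count_mem 1%N ls = 0%N.
  apply/eqP; rewrite -leqn0 leqNgt -has_count -all_predC; apply: sub_all als => l' /=; lia.
by have -> : (size ls).+2 = Delta by lia.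
Qed.
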